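(* For the Petersen graph $\mathcal{P}$, $o(\mathcal{P})=\mathcal{R}$ and $R_{\rm MB}(\mathcal{P})=R'_{\rm MB}(\mathcal{P})=3$.
   Context: A resolving set of $G$ is $W\subseteq V(G)$ such that for all distinct $x,y$ some $z\in W$ has $d(x,z)\neq d(y,z)$. In the Maker-Breaker resolving game on $G$, Resolver and Spoiler alternately select (without skipping) a not-yet-selected vertex; Resolver wins if at some point his vertices form a resolving set, otherwise Spoiler wins. $o(G)=\mathcal{R}$ means Resolver has a winning strategy both when he moves first and when Spoiler moves first. $R_{\rm MB}(G)$ (resp. $R'_{\rm MB}(G)$) is the minimum number of moves Resolver needs to win when he (resp. Spoiler) moves first, provided he has a winning strategy ($\infty$ otherwise). *)

(* Defs.v *)
From mathcomp Require Import all_boot boolp.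

Set Implicit Arguments.
Unset Strict Implicit.
Unset Printing Implicit Defensive.

Record sgraph := SGraph {
  vertex :> finType;
  adj : rel vertex;
  adj_sym : symmetric adj;
  adj_irrefl : irreflexive adj
}.

Section Distance.
Variable G : sgraph.

Definition has_path (x y : G) (n : nat) : bool :=
  [exists p : n.-tuple G,
     [&& path (@adj G) x p, last x p == y & uniq (x :: p)]].

(* Length of a shortest path.  Every path has length smaller than #|G|, and   *)
(* the value #|G| stands for infinity when no path exists.                    *)
Definition dist (x y : G) : nat := find (has_path x y) (iota 0 #|G|).

Definition resolving (W : {set G}) : Prop :=
  forall x y : G, x != y -> exists2 z, z \in W & dist x z != dist y z.

End Distance.

(* A position is the sequence of all vertices selected so far, in the order   *)
(* of selection; Resolver moves at the even times if rfirst is true, and at   *)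
(* the odd times otherwise.                                                   *)
Section Game.
Variables (G : sgraph) (rfirst : bool).

Definition resolver_turn (i : nat) : bool := odd i != rfirst.

Definition resolver_set (h : seq G) : {set G} :=
  [set x in h | resolver_turn (index x h)].

Definition complete_play (h : seq G) : Prop := uniq h /\ size h = #|G|.

Definition strategy := seq G -> G.

Definition legal (sigma : strategy) : Prop :=
  forall h : seq G, uniq h -> size h < #|G| -> resolver_turn (size h) ->
    sigma h \notin h.

Definition follows (sigma : strategy) (h : seq G) : Prop :=
  forall p x, prefix (rcons p x) h -> resolver_turn (size p) -> x = sigma p.

Definition resolver_wins : Prop :=
  exists2 sigma, legal sigma &
    forall h, complete_play h -> follows sigma h ->
      exists n, resolving (resolver_set (take n h)).

Definition resolver_wins_in (k : nat) : Prop :=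
  exists2 sigma, legal sigma &
    forall h, complete_play h -> follows sigma h ->
      exists2 n, #|resolver_set (take n h)| <= k
               & resolving (resolver_set (take n h)).

(* None stands for infinity *)
Definition min_moves : option nat :=
  match pselect (exists k, `[< resolver_wins_in k >]) with
  | left ex_k => Some (ex_minn ex_k)
  | right _ => None
  end.

End Game.

Definition outcome_R (G : sgraph) : Prop :=
  resolver_wins G true /\ resolver_wins G false.

Definition R_MB (G : sgraph) : option nat := min_moves G true.
Definition R_MB' (G : sgraph) : option nat := min_moves G false.

(* The Petersen graph as the Kneser graph K(5, 2) *)
Definition petersen_vertex : finType := {A : {set 'I_5} | #|A| == 2}.

Definition petersen_adj : rel petersen_vertex :=
  fun A B => [disjoint val A & val B].

Fact petersen_adj_sym : symmetric petersen_adj.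
Proof. by move=> A B; rewrite /petersen_adj disjoint_sym. Qed.

Fact petersen_adj_irrefl : irreflexive petersen_adj.
Proof.
move=> A; rewrite /petersen_adj -setI_eq0 setIid -cards_eq0.
by rewrite (eqP (valP A)).
Qed.

Definition petersen : sgraph := SGraph petersen_adj_sym petersen_adj_irrefl.

(* Main.v *)
(** Identify the vertices of the Petersen graph with the edges of [K_5], two of
    them being adjacent when they are disjoint.  Three edges through a common
    point [v] form a resolving set.  Resolver first selects an edge disjoint
    from Spoiler's opening one, if any.  Spoiler's next edge misses one of the
    two ends, say [v], so the star of [v] still contains three free edges;
    Resolver selects one of them, and Spoiler cannot take both others.
    Conversely, the diameter is 2, so the vertices outside a resolving set [W]
    are determined by their neighbourhoods in [W]; hence [10 <= |W| + 2 ^ |W|]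
    and [|W| >= 3]. *)

Require Import Defs.
From mathcomp Require Import all_boot boolp.

Set Implicit Arguments.
Unset Strict Implicit.
Unset Printing Implicit Defensive.

(** * Distances and resolving sets in finite graphs *)

Section DistanceTheory.
Variable G : sgraph.
Implicit Types (x y z : G) (W : {set G}).

Lemma has_path0 x y : has_path x y 0 = (x == y).
Proof.
apply/existsP/eqP => [[p]|->]; first by rewrite tuple0 /= andbT => /eqP.
by exists [tuple]; rewrite /= eqxx.
Qed.

Lemma has_path1 x y : has_path x y 1 = adj x y.
Proof.
apply/existsP/idP => [[p]|xy].
  case/tupleP: p => a p; rewrite tuple0 /= !andbT.
  by case/and3P=> xa /eqP <-.
exists [tuple y]; rewrite /= xy eqxx !andbT inE.
by apply: contraTneq xy => ->; rewrite adj_irrefl.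
Qed.

Lemma dist_le_path x y n : n < #|G| -> has_path x y n -> dist x y <= n.
Proof.
move=> ltn pn; rewrite leqNgt; apply/negP => /(before_find 0).
by rewrite nth_iota // add0n pn.
Qed.

Lemma dist_eq0 x y : (dist x y == 0) = (x == y).
Proof.
have: 0 < #|G| by apply/card_gt0P; exists x.
by rewrite /dist; case: #|_| => //= n _; rewrite has_path0; case: (x == y).
Qed.

Lemma distxx x : dist x x = 0.
Proof. by apply/eqP; rewrite dist_eq0. Qed.

Lemma dist_eq1 x y : (dist x y == 1) = adj x y.
Proof.
have [<-|neq_xy] := eqVneq x y.
  by rewrite adj_irrefl distxx.
have: 1 < #|G| by apply/card_gt1P; exists x, y.
rewrite /dist; case: #|_| => // [[|n]] // _ /=.
by rewrite has_path0 has_path1 (negPf neq_xy); case: (adj x y).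
Qed.

Lemma dist_common_neighbour x y z : adj x z -> adj z y -> dist x y <= 2.
Proof.
move=> xz zy; have [->|neq_xy] := eqVneq x y; first by rewrite distxx.
have neq_xz : x != z by apply: contraTneq xz => ->; rewrite adj_irrefl.
have neq_zy : z != y by apply: contraTneq zy => ->; rewrite adj_irrefl.
apply: dist_le_path.
  have <- : size [:: x; z; y] = 3 by [].
  apply: leq_trans (max_card [in [:: x; z; y]]).
  by rewrite (card_uniqP _) //= !inE negb_or neq_xz neq_xy neq_zy.
apply/existsP; exists [tuple z; y].
by rewrite /= !inE negb_or xz zy eqxx neq_xz neq_xy neq_zy.
Qed.

(** A vertex of [W] is the only one at distance 0 from itself, so distinct vertices that [W] fails
    to separate both lie outside [W]. They have the same neighbours in [W], since adjacency is
    distance 1. *)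
Lemma resolvingP W :
  (forall x y, x \notin W -> y \notin W ->
     {in W, forall z, adj x z = adj y z} -> x = y) ->
  resolving W.
Proof.
move=> injW x y neq_xy; apply/exists_inP/contraT => /exists_inPn same.
have eqd z : z \in W -> dist x z = dist y z.
  by move=> /same; rewrite negbK => /eqP.
case/eqP: (neq_xy); apply: injW => [||z Wz]; last by rewrite -!dist_eq1 eqd.
  by apply/negP => /eqd/esym/eqP; rewrite distxx dist_eq0 eq_sym (negPf neq_xy).
by apply/negP => /eqd/eqP; rewrite distxx dist_eq0 (negPf neq_xy).
Qed.

(** From outside [W], each vertex of [W] is at distance 1 or 2, so the distances are encoded by the
    set of neighbours in [W]. Hence the complement of [W] injects into the powerset of [W]. *)
Lemma card_resolving_diam2 W :
  (forall x y, dist x y <= 2) -> resolving W -> #|G| <= #|W| + 2 ^ #|W|.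
Proof.
move=> diam2 resW; rewrite -(cardsC W) leq_add2l -card_powerset.
pose f x := [set z in W | adj x z].
rewrite -(@card_in_imset _ _ f (~: W)).
  apply/subset_leq_card/subsetP => _ /imsetP[x _ ->].
  by rewrite powersetE; apply/subsetP => z; rewrite inE => /andP[].
move=> x y; rewrite !inE => nWx nWy /setP eqf; apply/eqP/contraT => neq_xy.
have [z Wz /eqP[]] := resW _ _ neq_xy.
have := eqf z; rewrite !inE Wz /= -!dist_eq1.
have: dist x z != 0 by rewrite dist_eq0; apply: contraNneq nWx => ->.
have: dist y z != 0 by rewrite dist_eq0; apply: contraNneq nWy => ->.
have := diam2 x z; have := diam2 y z.
by case: dist => [|[|[]]]; case: dist => [|[|[]]].
Qed.

End DistanceTheory.

(** * Plays, strategies and move counts in the resolving game *)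

Section GameTheory.
Variables (G : sgraph) (rfirst : bool).
Implicit Types (x : G) (h : seq G) (sigma : strategy G).

Notation turn := (resolver_turn rfirst).
Notation rset := (@resolver_set G rfirst).

Lemma resolver_set_rcons h x : x \notin h ->
  rset (rcons h x) = if turn (size h) then x |: rset h else rset h.
Proof.
move=> nhx; apply/setP => y.
rewrite (fun_if (fun A : {set G} => y \in A)) !inE mem_rcons inE -cats1 index_cat.
have [->|_] /= := eqVneq y x; last by rewrite if_same; case: (y \in h).
by rewrite (negPf nhx) /= eqxx addn0; case: ifP.
Qed.

Lemma resolver_set_sub h : {subset rset h <= h}.
Proof. by move=> x; rewrite inE => /andP[]. Qed.

Lemma card_resolver_set h : uniq h -> #|rset h| = (size h + rfirst)./2.
Proof.
elim/last_ind: h => [_|h x IHh].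
  have -> : rset [::] = set0 by apply/setP => x; rewrite !inE.
  by rewrite cards0; case: rfirst.
rewrite rcons_uniq => /andP[nhx Uh]; rewrite resolver_set_rcons // size_rcons.
rewrite addSn -uphalfE uphalf_half -(IHh Uh) oddD /resolver_turn.
have -> : odd rfirst = rfirst by case: rfirst.
rewrite -negb_add negbK; case: ifP => //= _.
by rewrite cardsU1 (contra _ nhx) // => /resolver_set_sub.
Qed.

Lemma ex_fresh h : size h < #|G| -> exists x, x \notin h.
Proof.
move=> lth; apply/existsP/contraT => /existsPn full.
suff: #|G| <= size h by rewrite leqNgt lth.
apply: leq_trans (card_size h); apply/subset_leq_card/subsetP => x _.
by have := full x; rewrite negbK.
Qed.

(* Resolver can force his set to be resolving after exactly [n] further
   selections, those of both players being counted. *)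
Fixpoint forced_win n h : Prop :=
  if n is m.+1 then
    if turn (size h) then exists2 x, x \notin h & forced_win m (rcons h x)
    else forall x, x \notin h -> forced_win m (rcons h x)
  else resolving (rset h).

(** By choice, [sigma] keeps a forced win whenever the position offers one, and otherwise selects
    any free vertex in order to stay legal. Along a play following [sigma], the forced win in
    [n - k] selections then persists after the first [k]. *)
Lemma forced_win_strategy n : 0 < n <= #|G| -> forced_win n [::] ->
  exists2 sigma, legal rfirst sigma &
    forall h, complete_play h -> follows rfirst sigma h ->
      resolving (rset (take n h)).
Proof.
case/andP=> n_gt0 len win0.
have /choice[sigma sigmaP] : forall h, exists x,
    (size h < #|G| -> x \notin h) /\
    (size h < n -> turn (size h) -> forced_win (n - size h) h ->
     forced_win (n - (size h).+1) (rcons h x)).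
  move=> h; have [lth|geh] := ltnP (size h) #|G|; last first.
    (* On sequences too long to be extended, the value of [sigma] is arbitrary. *)
    have /card_gt0P[x _] := leq_trans n_gt0 len; exists x; split=> // lth.
    by rewrite ltnNge (leq_trans len geh) in lth.
  have [[lthn th winh]|nwin] := pselect [/\ size h < n, turn (size h)
                                & forced_win (n - size h) h].
    move: winh; rewrite -subnSK //= th => -[x nhx winx]; by exists x.
  have [x nhx] := ex_fresh lth; exists x; split=> // *; by case: nwin.
exists sigma => [h _ lth _|h [Uh sz_h] sigma_h]; first by case: (sigmaP h) => ->.
suff win k : k <= n -> forced_win (n - k) (take k h).
  by have := win n (leqnn n); rewrite subnn.
elim: k => [_|k IHk ltkn]; first by rewrite subn0 take0.
have ltkh : k < size h by rewrite sz_h (leq_trans ltkn).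
have x0 : G by case: (h) ltkh.
have := IHk (ltnW ltkn); have sz_k : size (take k h) = k by rewrite size_takel // ltnW.
have nhk : nth x0 h k \notin take k h.
  by have := take_uniq k.+1 Uh; rewrite (take_nth x0) // rcons_uniq => /andP[].
rewrite (take_nth x0) //; have [tk|tk] := boolP (turn k).
  have -> : nth x0 h k = sigma (take k h).
    by apply: sigma_h; rewrite ?sz_k // -take_nth // prefix_take.
  by case: (sigmaP (take k h)) => _; rewrite sz_k; apply.
by rewrite -subnSK //= sz_k (negPf tk); apply.
Qed.

(** Lower bounds need this: a winning condition quantified over the plays following [sigma] says
    something only if such a play exists. *)
Lemma ex_complete_play sigma : legal rfirst sigma ->
  exists2 h, complete_play h & follows rfirst sigma h.
Proof.
move=> leg.
suff [h [Uh sz_h fh]] :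
  exists h, [/\ uniq h, size h = #|G| & follows rfirst sigma h] by exists h.
(* The induction builds a play of each length up to [#|G|]. *)
elim: {-2}#|G| (leqnn #|G|) => [_|n IHn ltn].
  by exists [::]; split=> // p x; rewrite prefixs0; case: p.
have [h [Uh sz_h fh]] := IHn (ltnW ltn).
have lth : size h < #|G| by rewrite sz_h.
have [x nhx xP] : exists2 x, x \notin h & turn (size h) -> x = sigma h.
  have [th|_] := boolP (turn (size h)); first by exists (sigma h); rewrite // leg.
  by have [x nhx] := ex_fresh lth; exists x.
exists (rcons h x); split; rewrite ?rcons_uniq ?nhx ?size_rcons ?sz_h // => p y.
(* A prefix of [rcons h x] is either the whole sequence or a prefix of [h]. *)
case/prefixP; elim/last_ind => [|t z _].
  by rewrite cats0 => /rcons_inj[<- <-].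
by rewrite -rcons_cat => /rcons_inj[eq_h _]; apply: fh; rewrite eq_h prefix_prefix.
Qed.

Lemma resolver_wins_inW k : resolver_wins_in G rfirst k -> resolver_wins G rfirst.
Proof.
case=> sigma leg win; exists sigma => // h ch fh.
by have [n _ res] := win h ch fh; exists n.
Qed.

Lemma forced_win_in n : 0 < n <= #|G| -> forced_win n [::] ->
  resolver_wins_in G rfirst (n + rfirst)./2.
Proof.
move=> len /(forced_win_strategy len)[sigma leg win]; exists sigma => // h ch fh.
exists n; last exact: win.
case: ch => Uh sz_h; case/andP: len => _ len.
by rewrite card_resolver_set ?take_uniq // size_takel ?sz_h.
Qed.

(** Any strategy winning in [m] moves has a play following it, in which Resolver owns a resolving
    set of at most [m] vertices; so [k <= m]. *)
Lemma min_moves_eq k : resolver_wins_in G rfirst k ->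
  (forall W : {set G}, resolving W -> k <= #|W|) -> min_moves G rfirst = Some k.
Proof.
move=> win lb; rewrite /min_moves; case: pselect => [ex_k|[]]; last first.
  by exists k; apply/asboolP.
congr Some; case: ex_minnP => m /asboolP[sigma leg winm] minm.
apply/eqP; rewrite eqn_leq minm /=; last by apply/asboolP.
have [h ch fh] := ex_complete_play leg.
by have [n le_m res] := winm h ch fh; apply: leq_trans le_m; apply: lb.
Qed.

End GameTheory.

(** * Diameter and resolving sets of the Petersen graph *)

Section Petersen.
Implicit Types (x y e f g s : petersen) (v a b c d : 'I_5) (h : seq petersen).

Lemma card_petersen : #|petersen| = 10.
Proof. by rewrite card_sig -cardsE card_draws card_ord. Qed.

Lemma ex_vertex (A : {set 'I_5}) : #|A| == 2 -> exists e, val e = A.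
Proof. by move=> cA; exists (exist (fun B : {set 'I_5} => #|B| == 2) A cA). Qed.

(** Distinct non-disjoint pairs share exactly one point, so their union has three points and its
    complement in ['I_5] is a common neighbour. *)
Lemma petersen_diam2 x y : dist x y <= 2.
Proof.
have [xy|nxy] := boolP (adj x y).
  by have := dist_eq1 x y; rewrite xy => /eqP->.
have [->|neq_xy] := eqVneq x y; first by rewrite distxx.
have card2 : #|~: (val x :|: val y)| == 2.
  have cx := eqP (valP x); have cy := eqP (valP y).
  have I0 : #|val x :&: val y| != 0 by rewrite cards_eq0 setI_eq0.
  have I2 : #|val x :&: val y| < 2.
    rewrite -[X in _ < X]cx proper_card // properEneq subsetIl andbT.
    apply: contra_neq neq_xy => /setIidPl sub; apply/val_inj/eqP.
    by rewrite eqEcard sub cx cy.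
  have I1 : #|val x :&: val y| = 1 by case: #|_| I0 I2 => [|[]].
  by rewrite cardsCs setCK card_ord cardsU cx cy I1.
have [z vz] := ex_vertex card2.
have adjz e : val e \subset val x :|: val y -> adj e z.
  by move=> sub; rewrite /adj /= /petersen_adj vz disjoints_subset setCK.
apply: (@dist_common_neighbour _ _ _ z).
  by apply: adjz; rewrite subsetUl.
by rewrite adj_sym; apply: adjz; rewrite subsetUr.
Qed.

Lemma card_petersen_resolving (W : {set petersen}) : resolving W -> 3 <= #|W|.
Proof.
move/(card_resolving_diam2 petersen_diam2); rewrite card_petersen.
by case: #|W| => [|[|[]]].
Qed.

Lemma ex_edge v a : v != a -> exists e, val e = [set v; a].
Proof.
by move=> neq; apply: ex_vertex; rewrite cards2 neq.
Qed.

Lemma uniq5_full v a b c d : uniq [:: v; a; b; c; d] ->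
  forall i, i \in [:: v; a; b; c; d].
Proof.
move=> U i; have sub : {subset [:: v; a; b; c; d] <= enum 'I_5}.
  by move=> j _; rewrite mem_enum.
by rewrite (uniq_min_size U sub) ?mem_enum ?size_enum_ord.
Qed.

Lemma ex_uniq5 v a : v != a -> exists b c d, uniq [:: v; a; b; c; d].
Proof.
move=> neq; have: size (enum (~: [set v; a])) = 3.
  by rewrite -cardE cardsCs setCK cards2 neq card_ord.
have := enum_uniq (~: [set v; a]).
have: {subset enum (~: [set v; a]) <= ~: [set v; a]} by move=> i; rewrite mem_enum.
case: (enum _) => [|b [|c [|d []]]] // sub U _; exists b, c, d.
rewrite cons_uniq (cons_uniq a) U andbT.
apply/andP; split; last by apply/negP => /sub; rewrite !inE eqxx orbT.
by rewrite inE (negPf neq) /=; apply/negP => /sub; rewrite !inE eqxx.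
Qed.

Lemma card_uniq5 v a b c d (A : {set 'I_5}) : uniq [:: v; a; b; c; d] ->
  #|A| = (v \in A) + ((a \in A) + ((b \in A) + ((c \in A) + (d \in A)))).
Proof.
move=> U; transitivity (count [in A] [:: v; a; b; c; d]); last by rewrite /= addn0.
rewrite -size_filter -(card_uniqP (filter_uniq _ U)); apply: eq_card => i.
by rewrite mem_filter uniq5_full // andbT.
Qed.

Lemma adj_edge x e v a : val e = [set v; a] ->
  adj x e = (v \notin val x) && (a \notin val x).
Proof.
move=> ve; rewrite /adj /= /petersen_adj ve disjoint_sym disjoints_subset.
by rewrite subUset !sub1set !inE.
Qed.

(** The only pair through [v] that can lie outside [W] is [{v, d}], which is adjacent to none of
    [ea], [eb], [ec]. A pair avoiding [v] is adjacent to [{v, i}] exactly when it misses [i]: its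
    adjacencies tell which of [a], [b], [c] it contains, its size decides on [d], and it misses at
    least one of [a], [b], [c]. *)
Lemma star_resolving (W : {set petersen}) v a b c d ea eb ec :
  uniq [:: v; a; b; c; d] ->
  val ea = [set v; a] -> val eb = [set v; b] -> val ec = [set v; c] ->
  ea \in W -> eb \in W -> ec \in W -> resolving W.
Proof.
move=> U va vb vc Wa Wb Wc; apply: resolvingP => x y nWx nWy same.
have notin z e i : val e = [set v; i] -> v != i -> e \in W -> z \notin W ->
    ~~ ((v \in val z) && (i \in val z)).
  move=> ve neq We; apply: contra => /andP[zv zi].
  suff <- : e = z by [].
  apply/val_inj/eqP; rewrite eqEcard ve subUset !sub1set zv zi cards2 neq.
  by rewrite (eqP (valP z)).
have [nva nvb nvc] : [/\ v != a, v != b & v != c].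
  by move: U; rewrite /= !inE !negb_or => /andP[/and4P[]].
have := same _ Wa; have := same _ Wb; have := same _ Wc.
rewrite !(adj_edge _ va) !(adj_edge _ vb) !(adj_edge _ vc).
have := notin x _ _ va nva Wa nWx; have := notin y _ _ va nva Wa nWy.
have := notin x _ _ vb nvb Wb nWx; have := notin y _ _ vb nvb Wb nWy.
have := notin x _ _ vc nvc Wc nWx; have := notin y _ _ vc nvc Wc nWy.
have := eqP (valP x); have := eqP (valP y); rewrite !(card_uniq5 _ U).
move=> cy cx H1 H2 H3 H4 H5 H6 E1 E2 E3; apply/val_inj/setP => i.
have := uniq5_full U i; rewrite !inE.
suff: [&& (v \in val x) == (v \in val y), (a \in val x) == (a \in val y),
  (b \in val x) == (b \in val y), (c \in val x) == (c \in val y)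
  & (d \in val x) == (d \in val y)].
  case/and5P=> /eqP ? /eqP ? /eqP ? /eqP ? /eqP ?.
  by do 4?case/predU1P=> [->//|]; move/eqP->.
move: cx cy H1 H2 H3 H4 H5 H6 E1 E2 E3.
(* A finite check over the ten membership bits of [x] and [y]. *)
case: (v \in val x); case: (v \in val y); case: (a \in val x); case: (a \in val y);
case: (b \in val x) => //; case: (b \in val y) => //; case: (c \in val x) => //;
case: (c \in val y) => //; by case: (d \in val x); case: (d \in val y).
Qed.

(** * Resolver's forced wins on the Petersen graph *)

Variable rfirst : bool.
Notation turn := (resolver_turn rfirst).
Notation rset := (@resolver_set petersen rfirst).

Lemma resolver_turnS n : turn n.+1 = ~~ turn n.
Proof. by rewrite /resolver_turn /=; case: odd; case: rfirst. Qed.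

(** The three selections are Resolver's [fb], Spoiler's [s], and whichever of [fc], [fd] Resolver
    still finds free; with [e] this gives three edges through [v]. *)
Lemma star_forced_win h v e : turn (size h) -> v \in val e -> e \in rset h ->
  (forall f : petersen, v \in val f -> f != e -> f \notin h) -> forced_win rfirst 3 h.
Proof.
move=> th ve he free.
have [a neq_va eq_e] : exists2 a, v != a & val e = [set v; a].
  have: #|val e :\ v| == 1 by have := valP e; rewrite (cardsD1 v) ve add1n eqSS.
  case/cards1P=> a ea; exists a; last by rewrite -ea setD1K.
  by have := set11 a; rewrite -ea !inE eq_sym => /andP[].
have [b [c [d U]]] := ex_uniq5 neq_va.
have := U; rewrite /= !inE !negb_or.
case/and5P=> /and4P[_ nvb nvc nvd] /and3P[nab nac nad] /andP[nbc nbd] ncd _.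
(* Exchanging [c] and [d] lets [fin] below serve for both final moves. *)
have Ud : uniq [:: v; a; b; d; c].
  rewrite /= !inE !negb_or neq_va nvb nvc nvd nab nac nad nbc nbd.
  by rewrite eq_sym ncd.
have edge i : v != i -> exists2 f : petersen, val f = [set v; i] & v \in val f.
  by move=> /ex_edge[f vf]; exists f; rewrite // vf !inE eqxx.
have neqf (f g : petersen) i j :
    val f = [set v; i] -> val g = [set v; j] -> v != i -> i != j -> f != g.
  move=> vf vg vi ij; apply: contraNneq ij => fg.
  have : i \in val g by rewrite -fg vf !inE eqxx orbT.
  by rewrite vg !inE eq_sym (negPf vi).
have [fb vb fbv] := edge b nvb; have [fc vc fcv] := edge c nvc.
have [fd vd fdv] := edge d nvd.
have neb : fb != e by apply: (neqf _ _ _ _ vb eq_e); rewrite // eq_sym.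
have nec : fc != e by apply: (neqf _ _ _ _ vc eq_e); rewrite // eq_sym.
have ned : fd != e by apply: (neqf _ _ _ _ vd eq_e); rewrite // eq_sym.
have nb := free _ fbv neb; have nc := free _ fcv nec; have nd := free _ fdv ned.
rewrite /= th; exists fb => //; rewrite !size_rcons !resolver_turnS th /= => s ns.
rewrite !size_rcons !resolver_turnS th /=.
have fin (f : petersen) i j :
    uniq [:: v; a; b; i; j] -> val f = [set v; i] ->
    f \notin h -> f != fb -> f != s ->
    exists2 x, x \notin rcons (rcons h fb) s &
      resolving (rset (rcons (rcons (rcons h fb) s) x)).
  move=> Uf vf nf nfb nfs.
  have nf' : f \notin rcons (rcons h fb) s.
    by rewrite mem_rcons in_cons mem_rcons in_cons !negb_or nfs nfb.
  exists f => //; rewrite !resolver_set_rcons // !size_rcons !resolver_turnS th /=.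
  by apply: (star_resolving Uf eq_e vb vf); rewrite !in_setU1 ?eqxx ?orbT // he !orbT.
have nfcb : fc != fb by apply: (neqf _ _ _ _ vc vb); rewrite // eq_sym.
have nfdb : fd != fb by apply: (neqf _ _ _ _ vd vb); rewrite // eq_sym.
have nfdc : fd != fc by apply: (neqf _ _ _ _ vd vc); rewrite // eq_sym.
have [sfc|nsfc] := eqVneq fc s; last exact: (fin fc c d U vc nc nfcb nsfc).
by apply: (fin fd d c Ud vd nd nfdb); rewrite -sfc.
Qed.

(** The earlier selections other than [e] meet neither end of [e]. Spoiler's next edge [s] differs
    from [e], hence misses an end [v], whose star is then untouched apart from [e]. *)
Lemma opening_forced_win h e : ~~ turn (size h) -> e \in rset h ->
  (forall f, f \in h -> f != e -> adj e f) -> forced_win rfirst 4 h.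
Proof.
move=> th he free.
rewrite [forced_win _ _ _]/= -/(forced_win rfirst 3) (negPf th) => s ns.
have /subsetPn[v ve vs] : ~~ (val e \subset val s).
  apply: contra ns => sub; suff <- : e = s by exact: resolver_set_sub he.
  by apply/val_inj/eqP; rewrite eqEcard sub (eqP (valP e)) (eqP (valP s)).
apply: (star_forced_win (v := v) (e := e)) => //.
- by rewrite size_rcons resolver_turnS.
- by rewrite resolver_set_rcons // (negPf th).
move=> f vf nfe; rewrite mem_rcons inE negb_or; apply/andP; split.
  by apply: contraNneq vs => <-.
apply/negP => /free/(_ nfe) /disjointFr/(_ ve).
by rewrite vf.
Qed.

End Petersen.

(** * Opening moves and the value of the game *)

Lemma petersen_neighbour (x : petersen) : exists y : petersen, adj x y.
Proof.
have: 1 < #|~: val x| by rewrite cardsCs setCK card_ord (eqP (valP x)).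
case/card_gt1P=> a [b [+ + neq]]; rewrite !inE => xa xb.
by have [e ve] := ex_edge neq; exists e; rewrite (adj_edge _ ve) xa.
Qed.

(** Any opening edge works. Of the five selections, Resolver makes the first, third and fifth. *)
Lemma petersen_forced_win_first : forced_win (G := petersen) true 5 [::].
Proof.
have [//|e _] := @ex_edge ord0 ord_max.
exists e => //; apply: (opening_forced_win (e := e)) => // [|f].
  by rewrite (resolver_set_rcons _ (h := [::])) //= !inE eqxx.
by rewrite inE => ->.
Qed.

(** Resolver answers with a neighbour of Spoiler's opening, so that both ends of his edge stay
    clear. Three of the six selections are his. *)
Lemma petersen_forced_win_second : forced_win (G := petersen) false 6 [::].
Proof.
move=> s _; have [e se] := petersen_neighbour s.
have nes : e != s by apply: contraTneq se => ->; rewrite adj_irrefl.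
exists e; first by rewrite inE.
apply: (opening_forced_win (e := e)) => // [|f].
  by rewrite (resolver_set_rcons _ (h := [:: s])) /= !inE ?eqxx.
by rewrite !inE => /orP[/eqP->|->//]; rewrite adj_sym.
Qed.

Theorem theorem4p7 :
  outcome_R petersen /\ R_MB petersen = Some 3 /\ R_MB' petersen = Some 3.
Proof.
have win1 : resolver_wins_in petersen true 3.
  by apply: (forced_win_in _ petersen_forced_win_first); rewrite card_petersen.
have win2 : resolver_wins_in petersen false 3.
  by apply: (forced_win_in _ petersen_forced_win_second); rewrite card_petersen.
split; first by split; [apply: resolver_wins_inW win1|apply: resolver_wins_inW win2].
by split; apply: min_moves_eq => //; exact: card_petersen_resolving.
Qed.
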